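(* For every infinite-time computable function $f$ (i.e. $f \in IT\text{-}\mathcal{C}$) such that the associated function $f^{*}:\mathbb{N}\to\mathbb{N}$ is total, we have $\Sigma_{\infty}(n) >^{*} f^{*}(n)$, i.e. there exists $N\in\mathbb{N}$ such that $\Sigma_{\infty}(n) > f^{*}(n)$ for all $n \geq N$.
   Context: Infinite-time Turing machines (ITTMs, in the sense of Hamkins and Lewis) are considered with three one-way infinite tapes (input, output, scratch), alphabet $\{0,1\}$, finitely many states including a special Limit state; at successor steps they act as ordinary Turing machines, and at limit steps each cell takes the limsup of its previous values, the head moves to the leftmost cell, and the machine enters the Limit state. $IT\text{-}\mathcal{C}$ denotes the set of all (partial) functions from Cantor space $\{0,1\}^{\mathbb{N}}$ to itself computable by such ITTMs (input on the input tape, output read from the output tape upon halting). For $n\in\mathbb{N}$, $\widehat{n}$ denotes the unary code of $n$: the tape content with ones in the first $n$ cells and zeros in all other cells. For $f\in IT\text{-}\mathcal{C}$, define the partial function $f^{*}:\mathbb{N}\to\mathbb{N}$ by $f^{*}(n)=k$ if $f(\widehat{n})=\widehat{k}$, and $f^{*}(n)$ undefined if there is no $k$ with $f(\widehat{n})=\widehat{k}$. For $n\in\mathbb{N}$, let $BB_{\infty}\text{-}n$ be the set of $f\in IT\text{-}\mathcal{C}$ such that $f^{*}(0)$ is defined and $f$ is computable by an ITTM with at most $n$ non-halting, non-limit states. Define $\Sigma_{\infty}:\mathbb{N}\to\mathbb{N}$ by $\Sigma_{\infty}(n)=\max_{f\in BB_{\infty}\text{-}n} f^{*}(0)$. For $g,h:\mathbb{N}\to\mathbb{N}$,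 $g(n)>^{*}h(n)$ means $g(n)>h(n)$ for all sufficiently large $n$. *)

(* Defs.v *)
From Stdlib Require Import ClassicalEpsilon.
From mathcomp Require Import all_boot.

Set Implicit Arguments.
Unset Strict Implicit.
Unset Printing Implicit Defensive.

Definition cantor := nat -> bool.

(** * Infinite-time Turing machines *)

Inductive move := MoveLeft | MoveRight.

(* The states from which a machine acts. *)
Inductive live (Q : Type) := Work of Q | Limit.
Arguments Limit {Q}.

(* [None] is the halting state, so that the states of a machine are the
   elements of [Q] together with one limit state and one halting state. *)
Definition state (Q : Type) := option (live Q).

(* The contents of one cell of the input, output and scratch tapes. *)
Definition symbol := (bool * bool * bool)%type.

Record ittm := Ittm {
  work : finType;
  start : state work;
  delta : live work -> symbol -> state work * symbol * move
}.

(* As in Hamkins and Lewis, a single head scans the three tapes in parallel. *)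
Record config (Q : Type) := Config {
  st : state Q;
  head : nat;
  inp : cantor;
  outp : cantor;
  scr : cantor
}.

Definition write (t : cantor) (i : nat) (b : bool) : cantor :=
  fun j => if j == i then b else t j.

(* [0.-1 = 0]: a left move on the leftmost cell leaves the head in place. *)
Definition move_head (d : move) (i : nat) : nat :=
  match d with MoveLeft => i.-1 | MoveRight => i.+1 end.

Definition init (M : ittm) (x : cantor) : config (work M) :=
  Config (start M) 0 x (fun=> false) (fun=> false).

Definition step (M : ittm) (q : live (work M)) (c : config (work M)) :
    config (work M) :=
  let i := head c in
  let: (q', (a, b, s), d) := delta q (inp c i, outp c i, scr c i) in
  Config q' (move_head d i)
    (write (inp c) i a) (write (outp c) i b) (write (scr c) i s).

(** * Transfinite computations *)

(* Ordinal time is represented by arbitrary (strict) well-orders. *)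
Definition well_order (W : Type) (lt : W -> W -> Prop) : Prop :=
  [/\ well_founded lt,
      forall r s t, lt r s -> lt s t -> lt r t
    & forall s t, lt s t \/ s = t \/ lt t s].

Section Runs.

Variables (W : Type) (lt : W -> W -> Prop).

Definition is_first (s : W) : Prop := forall t, ~ lt t s.

Definition is_last (s : W) : Prop := forall t, lt t s \/ t = s.

Definition is_succ (t s : W) : Prop :=
  lt t s /\ forall u, ~ (lt t u /\ lt u s).

Definition is_limit (s : W) : Prop :=
  ~ is_first s /\ forall t, ~ is_succ t s.

(* [b] is the limsup of the bits [v t] as [t] tends to [s] from below. *)
Definition is_limsup (v : W -> bool) (s : W) (b : bool) : Prop :=
  b <-> forall t, lt t s -> exists u, [/\ ~ lt u t, lt u s & v u].

Definition limit_config (Q : Type) (c : W -> config Q) (s : W) : Prop :=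
  [/\ st (c s) = Some Limit,
      head (c s) = 0,
      forall i, is_limsup (fun t => inp (c t) i) s (inp (c s) i),
      forall i, is_limsup (fun t => outp (c t) i) s (outp (c s) i)
    & forall i, is_limsup (fun t => scr (c t) i) s (scr (c s) i)].

(* The successor clause forbids any stage after a halting one. *)
Definition is_run (M : ittm) (x : cantor) (c : W -> config (work M)) : Prop :=
  [/\ forall s, is_first s -> c s = init M x,
      forall t s, is_succ t s ->
        exists2 q, st (c t) = Some q & c s = step q (c t)
    & forall s, is_limit s -> limit_config c s].

End Runs.

Definition halts_with (M : ittm) (x y : cantor) : Prop :=
  exists (W : Type) (lt : W -> W -> Prop) (c : W -> config (work M)) (m : W),
    [/\ well_order lt, is_last lt m, is_run lt x c,
        st (c m) = None & outp (c m) = y].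

(* Partial functions on Cantor space; [None] means undefined. *)
Definition computes (M : ittm) (f : cantor -> option cantor) : Prop :=
  forall x y, f x = Some y <-> halts_with M x y.

Definition IT_C (f : cantor -> option cantor) : Prop :=
  exists M, computes M f.

(** * The infinite-time busy beaver function *)

Definition unary (n : nat) : cantor := fun i => i < n.

(* The graph of the partial function f^*; it is single-valued because [unary]
   is injective. *)
Definition star (f : cantor -> option cantor) (n k : nat) : Prop :=
  f (unary n) = Some (unary k).

Definition BB (n : nat) (f : cantor -> option cantor) : Prop :=
  (exists k, star f 0 k) /\ exists M, #|work M| <= n /\ computes M f.

Definition is_max (A : nat -> Prop) (m : nat) : Prop :=
  A m /\ forall k, A k -> k <= m.

(* The maximum exists for every [n], as there are only finitely many machines
   with at most [n] working states up to renaming the states. *)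
Definition Sigma (n : nat) : nat :=
  epsilon (inhabits 0) (is_max (fun k => exists2 f, BB n f & star f 0 k)).

Definition eventually_gt (g h : nat -> nat) : Prop :=
  exists N, forall n, N <= n -> h n < g n.

(* Main.v *)
(**
  Let [M] compute [f].  From blank tapes, a finite machine first writes the
  unary code of [n] on the input tape, then runs [M], and finally lengthens the
  output: this yields some [p > f^*(n)].  Writing [n] must save a constant
  number of states over the naive writer, to pay for the working states of [M]
  and for the rewinding and lengthening phases.  A gadget writing three cells
  with two states saves one state, so a fixed number of gadgets does it, the
  other cells being written with one state each.  Only [M] ever reaches a limit
  stage, so the limit state need not be shared between the phases.

  [Sigma] is a genuine maximum, because runs are deterministic (stages of equal
  rank in two runs carry equal configurations) and because every machine with
  at most [n] working states is simulated by one whose states are ['I_n].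
*)
From HB Require Import structures.
From Stdlib Require Import ClassicalEpsilon FunctionalExtensionality.
From Pilot Require (* [seq.head] would otherwise hide the field [head] of [config]. *)
Import Defs.
From mathcomp Require Import all_boot.
From mathcomp Require Import zify.
Import Defs.

Set Implicit Arguments.
Unset Strict Implicit.
Unset Printing Implicit Defensive.

(** * Determinism of transfinite runs *)

Lemma wf_minimal (W : Type) (lt : W -> W -> Prop) (P : W -> Prop) (s : W) :
  well_founded lt -> P s -> exists2 t, P t & forall u, lt u t -> ~ P u.
Proof.
move=> wf; elim/(well_founded_ind wf): s => s IHs Ps.
have [[t [lts Pt]] | noP] := excluded_middle_informative (exists t, lt t s /\ P t).
  exact: IHs lts Pt.
by exists s => // u lus Pu; apply: noP; exists u.
Qed.

Lemma wf_irreflexive (W : Type) (lt : W -> W -> Prop) s :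
  well_founded lt -> ~ lt s s.
Proof.
move=> wf; elim/(well_founded_ind wf): s => s IHs lss; exact (IHs s lss lss).
Qed.

Lemma exists_succ (W : Type) (lt : W -> W -> Prop) (s t : W) :
  well_order lt -> lt s t -> exists u, is_succ lt s u.
Proof.
move=> [wf _ _] lst; have [u lsu minu] := wf_minimal (P := lt s) wf lst.
by exists u; split=> // v [lsv lvu]; apply: minu lsv.
Qed.

Section RankEquality.

Variables (W V : Type) (ltW : W -> W -> Prop) (ltV : V -> V -> Prop).

(* Equality of the ordinals below [s] and [r], as a bisimulation: this avoids
   building an order isomorphism between initial segments. *)
Inductive same_rank (s : W) (r : V) : Prop :=
  SameRank of (forall t, ltW t s -> exists2 p, ltV p r & same_rank t p)
            & (forall p, ltV p r -> exists2 t, ltW t s & same_rank t p).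

End RankEquality.

Lemma same_rank_sym (W V : Type) (ltW : W -> W -> Prop) (ltV : V -> V -> Prop)
    (wo : well_order ltW) s r :
  same_rank ltW ltV s r -> same_rank ltV ltW r s.
Proof.
case: wo => wf _ _; elim/(well_founded_ind wf): s r => s IHs r [Esr Ers].
split=> [p /Ers[t lts Etp] | t lts]; first by exists t => //; apply: IHs.
by have [p lpr Etp] := Esr t lts; exists p => //; apply: IHs.
Qed.

Section RankEqualityTheory.

Variables (W V : Type) (ltW : W -> W -> Prop) (ltV : V -> V -> Prop).
Hypotheses (woW : well_order ltW) (woV : well_order ltV).

Local Notation same := (same_rank ltW ltV).

(** Descent on [s]: if [p] lay below [r], it would match some [t] below [s], and [t] would also
    match some [q] below [p], giving the same situation at [t]. *)
Lemma same_rank_inj_lt s p r : same s p -> same s r -> ~ ltV p r.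
Proof.
case: woW => wf _ _; elim/(well_founded_ind wf): s p r => s IHs p r Esp Esr lpr.
case: Esr => _ /(_ p lpr)[t lts Etp]; case: (Esp) => /(_ t lts)[q lqp Etq] _.
exact: IHs lts _ _ Etq Etp lqp.
Qed.

Lemma same_rank_trichotomy s r :
  [\/ same s r, exists2 t, ltW t s & same t r | exists2 p, ltV p r & same s p].
Proof.
case: woW woV => wfW trW _ [wfV trV _].
elim/(well_founded_ind wfW): s r => s IHs r.
elim/(well_founded_ind wfV): r => r IHr.
have [? | no_t] := excluded_middle_informative (exists2 t, ltW t s & same t r).
  by constructor 2.
have [? | no_p] := excluded_middle_informative (exists2 p, ltV p r & same s p).
  by constructor 3.
constructor 1; split=> [t lts | p lpr].
  case: (IHs t lts r) => [Etr | [u lut Eur] | //].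
    by case: no_t; exists t.
  by case: no_t; exists u => //; apply: trW lut lts.
case: (IHr p lpr) => [Esp | // | [q lqp Esq]].
  by case: no_p; exists p.
by case: no_p; exists q => //; apply: trV lqp lpr.
Qed.

Lemma same_rank_first s r : same s r -> is_first ltW s -> is_first ltV r.
Proof. by case=> _ Ers first_s p /Ers[t lts _]; apply: first_s lts. Qed.

End RankEqualityTheory.

Section RankEqualityRuns.

Variables (W V : Type) (ltW : W -> W -> Prop) (ltV : V -> V -> Prop).
Hypotheses (woW : well_order ltW) (woV : well_order ltV).

Local Notation same := (same_rank ltW ltV).

Lemma same_rank_inj_ltl s t r : same s r -> same t r -> ~ ltW s t.
Proof.
move=> Esr Etr.
exact (same_rank_inj_lt woV (same_rank_sym woW Esr) (same_rank_sym woW Etr)).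
Qed.

(** A [q] strictly between [p] and [r] would match some [u] below [s]; the element below [u]
    matching [p] must be [t] by injectivity, so [u] would lie strictly between [t] and [s]. *)
Lemma same_rank_succ s r t : same s r -> is_succ ltW t s ->
  exists2 p, is_succ ltV p r & same t p.
Proof.
move=> [Esr Ers] [lts succ_t]; have [p lpr Etp] := Esr t lts.
exists p => //; split=> // q [lpq lqr]; have [u lus Euq] := Ers q lqr.
case: (Euq) => _ /(_ p lpq)[v lvu Evp].
case: woW => _ trW /(_ v t)[lvt | [evt | ltv]].
- exact: same_rank_inj_ltl Evp Etp lvt.
- by apply: (succ_t u); rewrite -evt.
- exact: same_rank_inj_ltl Etp Evp ltv.
Qed.

Lemma same_rank_limsup s r (v : W -> bool) (w : V -> bool) (b d : bool) :
  same s r -> (forall t p, ltW t s -> same t p -> v t = w p) ->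
  is_limsup ltW v s b -> is_limsup ltV w r d -> b -> d.
Proof.
move=> [Esr Ers] evw [lim_v _] [_ lim_w] bT; apply: lim_w => p lpr.
have [t lts Etp] := Ers p lpr; have [u [le_tu lus vu]] := lim_v bT t lts.
have [q lqr Euq] := Esr u lus; exists q; split=> //; last by rewrite -(evw u).
move=> lqp; case: Etp => _ /(_ q lqp)[x lxt Exq].
suff lxu : ltW x u by apply: same_rank_inj_ltl Exq Euq lxu.
case: woW => _ trW /(_ u t)[// | [-> // | ltu]]; exact: trW lxt ltu.
Qed.

End RankEqualityRuns.

Lemma limit_config_ext (W V : Type) (ltW : W -> W -> Prop) (ltV : V -> V -> Prop)
    (Q : Type) (c : W -> config Q) (d : V -> config Q) s r :
  well_order ltW -> well_order ltV -> same_rank ltW ltV s r ->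
  (forall t p, ltW t s -> same_rank ltW ltV t p -> c t = d p) ->
  limit_config ltW c s -> limit_config ltV d r -> c s = d r.
Proof.
move=> woW woV Esr ecd.
have bit (g : config Q -> nat -> bool) :
    (forall i, is_limsup ltW (fun t => g (c t) i) s (g (c s) i)) ->
    (forall i, is_limsup ltV (fun t => g (d t) i) r (g (d r) i)) ->
  g (c s) = g (d r).
  move=> limW limV; apply: functional_extensionality => i; apply/idP/idP.
    by apply: (same_rank_limsup woW woV Esr _ (limW i) (limV i)) => t p lts /ecd->.
  apply: (same_rank_limsup woV woW (same_rank_sym woW Esr) _ (limV i) (limW i)).
  move=> p t lpr Ept; have Etp := same_rank_sym woV Ept; rewrite (ecd t p) //.
  (* [t] is not yet known to lie below [s]; it is compared with an [x] below [s] that matches the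
     same [p]. *)
  have [x lxs Exp] : exists2 x, ltW x s & same_rank ltW ltV x p.
    by case: Esr => _; apply.
  case: (woW) => _ _ /(_ x t)[lxt | [<- // | ltx]].
    by case: (same_rank_inj_ltl woW woV Exp Etp lxt).
  by case: (woW) => _ trW _; apply: trW ltx lxs.
case=> st_c hd_c inp_c outp_c scr_c [st_d hd_d inp_d outp_d scr_d].
move: (bit _ inp_c inp_d) (bit _ outp_c outp_d) (bit _ scr_c scr_d) st_c hd_c st_d hd_d.
by case: (c s) (d r) => ? ? ? ? ? [? ? ? ? ?] /= -> -> -> -> -> -> ->.
Qed.

(** Runs from an arbitrary configuration can be composed; for [c0 = init M x] this is convertible to
    [is_run]. *)
Definition run_from (W : Type) (lt : W -> W -> Prop) (M : ittm)
    (c0 : config (work M)) (c : W -> config (work M)) : Prop :=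
  [/\ forall s, is_first lt s -> c s = c0,
      forall t s, is_succ lt t s ->
        exists2 q, st (c t) = Some q & c s = step q (c t)
    & forall s, is_limit lt s -> limit_config lt c s].

Lemma run_from_deterministic (M : ittm) c0 (W V : Type) (ltW : W -> W -> Prop)
    (ltV : V -> V -> Prop) (c : W -> config (work M)) (d : V -> config (work M)) s r :
  well_order ltW -> well_order ltV -> run_from ltW c0 c -> run_from ltV c0 d ->
  same_rank ltW ltV s r -> c s = d r.
Proof.
move=> woW woV [c_first c_succ c_lim] [d_first d_succ d_lim].
case: (woW) => wf _ _; elim/(well_founded_ind wf): s r => s IHs r Esr.
have Ers := same_rank_sym woW Esr.
have [first_s | not_first] := excluded_middle_informative (is_first ltW s).
  by rewrite c_first // d_first //; apply: same_rank_first Esr first_s.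
have [[t succ_t] | not_succ] := excluded_middle_informative (exists t, is_succ ltW t s).
  have [p succ_p Etp] := same_rank_succ woW woV Esr succ_t.
  have [q st_q ->] := c_succ _ _ succ_t; have [q' st_q' ->] := d_succ _ _ succ_p.
  have ecd : c t = d p by apply: IHs Etp; case: succ_t.
  by move: st_q'; rewrite -ecd st_q => -[->].
apply: (limit_config_ext woW woV Esr (fun t p lts => IHs t lts p)).
  by apply: c_lim; split=> // t succ_t; apply: not_succ; exists t.
apply: d_lim; split=> [first_r | p succ_p].
  by apply: not_first; apply: same_rank_first Ers first_r.
by have [t succ_t _] := same_rank_succ woV woW Ers succ_p; apply: not_succ; exists t.
Qed.

Lemma halt_is_maximal (M : ittm) c0 (W : Type) (lt : W -> W -> Prop)
    (c : W -> config (work M)) s t :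
  well_order lt -> run_from lt c0 c -> lt s t -> st (c s) <> None.
Proof.
move=> wo [_ c_succ _] lst; have [u succ_u] := exists_succ wo lst.
by have [q -> _] := c_succ _ _ succ_u.
Qed.

(** If the two last stages had different ranks, one run would contain a halting stage that is not
    its last. *)
Lemma halts_with_inj (M : ittm) x y z :
  halts_with M x y -> halts_with M x z -> y = z.
Proof.
move=> [W [ltW [c [m [woW _ run_c halt_c <-]]]]].
move=> [V [ltV [d [p [woV _ run_d halt_d <-]]]]].
have eq_cd := run_from_deterministic woW woV run_c run_d.
case: (same_rank_trichotomy woW woV m p) => [/eq_cd-> // | [t ltm Etp] | [q lqp Emq]].
  by case: (halt_is_maximal woW run_c ltm); rewrite (eq_cd _ _ Etp).
by case: (halt_is_maximal woV run_d lqp); rewrite -(eq_cd _ _ Emq).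
Qed.

Lemma computable_function_of (M : ittm) : exists f, computes M f.
Proof.
exists (fun x => if excluded_middle_informative (exists y, halts_with M x y) is
  left ex_y then Some (proj1_sig (constructive_indefinite_description _ ex_y)) else None).
move=> x y; case: excluded_middle_informative => [ex_y | no_y]; last first.
  by split=> // halt_y; case: no_y; exists y.
case: constructive_indefinite_description => z halt_z /=.
by split=> [[<-] // | /(halts_with_inj halt_z)->].
Qed.

(** * Composing runs *)

Definition reach (M : ittm) (c0 c1 : config (work M)) : Prop :=
  exists (W : Type) (lt : W -> W -> Prop) (c : W -> config (work M)) (m : W),
    [/\ well_order lt, is_last lt m, run_from lt c0 c & c m = c1].

Lemma halts_withP (M : ittm) x y : halts_with M x y <->
  exists2 d, reach (init M x) d & st d = None /\ outp d = y.
Proof.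
split=> [[W [lt [c [m [wo last_m run_c halt_c out_c]]]]] | [d]].
  by exists (c m) => //; exists W, lt, c, m.
move=> [W [lt [c [m [wo last_m run_c <-]]]]] [halt_c out_c].
by exists W, lt, c, m.
Qed.

(** Only the run of [M] may be transfinite, so adding one stage at either end, repeatedly, replaces
    general sums of well-orders. *)
Definition add_bottom (W : Type) (lt : W -> W -> Prop) (s t : option W) : Prop :=
  match s, t with
  | None, Some _ => True
  | Some s, Some t => lt s t
  | _, None => False
  end.

Definition add_top (W : Type) (lt : W -> W -> Prop) (s t : option W) : Prop :=
  match s, t with
  | Some _, None => True
  | Some s, Some t => lt s t
  | None, _ => False
  end.

Lemma well_order_add_bottom (W : Type) (lt : W -> W -> Prop) :
  well_order lt -> well_order (add_bottom lt).
Proof.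
move=> [wf tr tot]; split.
- have acc0 : Acc (add_bottom lt) None by split; case.
  case=> [s|]; last exact: acc0.
  elim/(well_founded_ind wf): s => s IHs; split=> -[t lts|_]; last exact: acc0.
  exact: IHs.
- by move=> [r|] [s|] [t|] //=; apply: tr.
- move=> [s|] [t|] /=; [|by right; right|by left|by right; left].
  by case: (tot s t) => [|[->|]]; [left|right; left|right; right].
Qed.

Lemma well_order_add_top (W : Type) (lt : W -> W -> Prop) :
  well_order lt -> well_order (add_top lt).
Proof.
move=> [wf tr tot]; split.
- have accS s : Acc (add_top lt) (Some s).
    by elim/(well_founded_ind wf): s => s IHs; split=> -[t lts|[]]; apply: IHs.
  by case=> [s|]; [|split=> -[s _|[]]]; apply: accS.
- by move=> [r|] [s|] [t|] //=; apply: tr.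
- move=> [s|] [t|] /=; [|by left|by right; right|by right; left].
  by case: (tot s t) => [|[->|]]; [left|right; left|right; right].
Qed.

Lemma limit_config_add_bottom (W : Type) (lt : W -> W -> Prop) (Q : Type)
    (c0 : config Q) (c : W -> config Q) s :
  ~ is_first lt s -> limit_config lt c s ->
  limit_config (add_bottom lt) (oapp c c0) (Some s).
Proof.
move=> not_first.
have [x lxs] : exists x, lt x s.
  apply: NNPP => no_x; apply: not_first => t lts; apply: no_x; by exists t.
have lim (g : config Q -> bool) b :
    is_limsup lt (fun t => g (c t)) s b ->
  is_limsup (add_bottom lt) (fun t => g (oapp c c0 t)) (Some s) b.
  move=> [limP limN]; split=> [bT | lim_b].
    have limS t : lt t s -> exists u,
        [/\ ~ add_bottom lt u (Some t), add_bottom lt u (Some s) & g (oapp c c0 u)].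
      by move=> /(limP bT)[u uP]; exists (Some u).
    case=> [t lts | _]; first exact: limS.
    (* For the new bottom stage as bound, any witness found above some [x] below [s] will do. *)
    have [u [_ lus gu]] := limS x lxs.
    by exists u; split=> //; case: (u) => [?|] [].
  apply: limN => t lts.
  have [[u|] [ntu lus gu]] := lim_b (Some t) lts; first by exists u.
  by case: ntu.
case=> st_c hd_c inp_c outp_c scr_c; split=> // i.
- exact: (lim (fun c => inp c i)).
- exact: (lim (fun c => outp c i)).
- exact: (lim (fun c => scr c i)).
Qed.

Lemma limit_config_add_top (W : Type) (lt : W -> W -> Prop) (Q : Type)
    (c1 : config Q) (c : W -> config Q) s :
  limit_config lt c s -> limit_config (add_top lt) (oapp c c1) (Some s).
Proof.
have lim (g : config Q -> bool) b :
    is_limsup lt (fun t => g (c t)) s b ->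
  is_limsup (add_top lt) (fun t => g (oapp c c1 t)) (Some s) b.
  move=> [limP limN]; split=> [bT | lim_b].
    by case=> [t lts |//]; have [u uP] := limP bT t lts; exists (Some u).
  by apply: limN => t lts; have [[u|] [ntu lus gu]] := lim_b (Some t) lts; first exists u.
case=> st_c hd_c inp_c outp_c scr_c; split=> // i.
- exact: (lim (fun c => inp c i)).
- exact: (lim (fun c => outp c i)).
- exact: (lim (fun c => scr c i)).
Qed.

Lemma reach_step_left (M : ittm) q (c0 c1 : config (work M)) :
  st c0 = Some q -> reach (step q c0) c1 -> reach c0 c1.
Proof.
move=> st0 [W [lt [c [m [wo last_m [c_first c_succ c_lim] <-]]]]].
exists (option W), (add_bottom lt), (oapp c c0), (Some m); split; last by [].
- exact: well_order_add_bottom.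
- case=> [s|]; last by left.
  by case: (last_m s) => [|->]; [left | right].
- split=> [[s|] first_s // | t [s|] [lts succ_t] | [s|] [not_first not_succ]] //=.
  + by case: (first_s None).
  + case: t lts succ_t => [t|] /= lts succ_t.
      by apply: c_succ; split=> // u; apply: (succ_t (Some u)).
    by exists q => //; apply: c_first => u lus; apply: (succ_t (Some u)).
  + by case: t lts {succ_t} => [t|].
  + have not_first_s : ~ is_first lt s.
      by move=> first_s; apply: (not_succ None); split=> // -[u|] [] // _; apply: first_s.
    apply: limit_config_add_bottom => //; apply: c_lim; split=> // t [lts succ_t].
    by apply: (not_succ (Some t)); split=> // -[u|] [] // ltu lus; apply: (succ_t u).
  + by case: not_first => -[t|] [].
Qed.

Lemma reach_step_right (M : ittm) q (c0 c1 : config (work M)) :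
  st c1 = Some q -> reach c0 c1 -> reach c0 (step q c1).
Proof.
move=> st1 [W [lt [c [m [wo last_m [c_first c_succ c_lim] ec1]]]]].
exists (option W), (add_top lt), (oapp c (step q c1)), None; split; last by [].
- exact: well_order_add_top.
- by case=> [s|]; [left | right].
- split=> [[s|] first_s | [t|] [s|] [lts succ_t] | [s|] [not_first not_succ]] //=.
  + by apply: c_first => t; apply: (first_s (Some t)).
  + by case: (first_s (Some m)).
  + by apply: c_succ; split=> // u; apply: (succ_t (Some u)).
  + case: (last_m t) => [ltm | ->]; first by case: (succ_t (Some m)).
    by rewrite ec1; exists q.
  + apply: limit_config_add_top; apply: c_lim; split=> [first_s | t [lts succ_t]].
      by apply: not_first => -[t|] //; apply: first_s.
    by apply: (not_succ (Some t)); split=> // -[u|] [] // ltu lus; apply: (succ_t u).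
  (* The added top is the successor of the old last stage [m], hence no limit. *)
  + case: (not_succ (Some m)); split=> // -[u|] [] //= lmu _.
    case: wo => wf tr _; case: (last_m u) => [lum | eum].
      by apply: (wf_irreflexive wf (tr _ _ _ lum lmu)).
    by rewrite eum in lmu; apply: (wf_irreflexive wf lmu).
Qed.

Inductive steps (M : ittm) (c : config (work M)) : config (work M) -> Prop :=
  | StepsRefl : steps c c
  | StepsCons q d : st c = Some q -> steps (step q c) d -> steps c d.

Lemma steps_trans (M : ittm) (a b c : config (work M)) :
  steps a b -> steps b c -> steps a c.
Proof. by elim=> // {a b} a q b st_a _ IH /IH; apply: StepsCons. Qed.

Lemma reach_steps_left (M : ittm) (a b c : config (work M)) :
  steps a b -> reach b c -> reach a c.
Proof. by elim=> // {a b} a q b st_a _ IH /IH; apply: reach_step_left. Qed.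

Lemma reach_steps_right (M : ittm) (a b c : config (work M)) :
  reach a b -> steps b c -> reach a c.
Proof.
move=> + steps_bc; elim: steps_bc => // {b c} b q c st_b _ IH reach_ab.
by apply: IH; apply: reach_step_right.
Qed.

(** * Simulation of one machine by another *)

Definition map_config (P Q : Type) (g : state P -> state Q) (c : config P) : config Q :=
  Config (g (st c)) (head c) (inp c) (outp c) (scr c).

(** The image of the halting state is left free, so that [N] may go on computing where [M] halts. *)
Definition simulation (M N : ittm) (g : state (work M) -> state (work N)) : Prop :=
  g (Some Limit) = Some Limit /\
  forall q, exists2 q', g (Some q) = Some q' &
    forall x, delta q' x = let: (p, y, d) := delta q x in (g p, y, d).

(** Head and tapes are untouched by [map_config], so the same well-order serves and the limsup
    conditions carry over as they are. *)
Lemma reach_simulation (M N : ittm) (g : state (work M) -> state (work N)) c0 c1 :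
  simulation g -> reach c0 c1 -> reach (map_config g c0) (map_config g c1).
Proof.
move=> [g_lim g_sim] [W [lt [c [m [wo last_m [c_first c_succ c_lim] <-]]]]].
exists W, lt, (map_config g \o c), m; split; [exact: wo | exact: last_m | | by []].
split=> [s /c_first /= -> // | t s | s].
  move=> /c_succ[q st_q step_t]; have [q' gq delta_q'] := g_sim q.
  exists q'; rewrite /= ?st_q // step_t /step delta_q' /=.
  by case: (delta q _) => -[p [[a b] e]] d.
by move=> /c_lim[st_c hd_c inp_c outp_c scr_c]; split; rewrite /= ?st_c.
Qed.

(** * Finiteness of the values *)

(** Finiteness of [live] and [move] makes the transition tables over ['I_n] a finite type. *)
Definition opt_of_live (Q : Type) (q : live Q) : option Q :=
  if q is Work q then Some q else None.

Definition live_of_opt (Q : Type) (q : option Q) : live Q :=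
  if q is Some q then Work q else Limit.

Lemma opt_of_liveK (Q : Type) : cancel (@opt_of_live Q) (@live_of_opt Q).
Proof. by case. Qed.

HB.instance Definition _ (Q : finType) :=
  Finite.copy (live Q) (can_type (@opt_of_liveK Q)).

Definition bool_of_move (d : move) : bool := if d is MoveLeft then true else false.

Definition move_of_bool (b : bool) : move := if b then MoveLeft else MoveRight.

Lemma bool_of_moveK : cancel bool_of_move move_of_bool.
Proof. by case. Qed.

HB.instance Definition _ := Finite.copy move (can_type bool_of_moveK).

Definition code (n : nat) : finType :=
  (state 'I_n * {ffun live 'I_n * symbol -> state 'I_n * symbol * move})%type.

Definition decode (n : nat) (e : code n) : ittm :=
  @Ittm 'I_n e.1 (fun q x => e.2 (q, x)).

Lemma halts_with_code (M : ittm) n x y :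
  #|work M| <= n -> halts_with M x y -> exists e : code n, halts_with (decode e) x y.
Proof.
move=> le_n /halts_withP[d reach_d [halt_d out_d]].
have [phi phi_inj] : exists phi : work M -> 'I_n, injective phi.
  exists (fun q => widen_ord le_n (enum_rank q)).
  by move=> p q /(congr1 val)/= /val_inj/enum_rank_inj.
pose live_phi (q : live (work M)) := if q is Work q then Work (phi q) else Limit.
have live_phi_inj : injective live_phi by move=> [p|] [q|] // [/phi_inj->].
pose g := omap live_phi.
(* States outside the image of [live_phi] get a dummy halting instruction; the simulated run never
   enters them. *)
pose table : {ffun live 'I_n * symbol -> state 'I_n * symbol * move} := [ffun p =>
  if [pick q | live_phi q == p.1] is Some q then
    let: (p, y, d) := delta q p.2 in (g p, y, d)
  else (None, p.2, MoveLeft)].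
pose e : code n := (g (start M), table).
have sim_g : @simulation M (decode e) g.
  split=> // q; exists (live_phi q) => // z; rewrite /= ffunE /=.
  by case: pickP => [p /eqP/live_phi_inj-> // | /(_ q)]; rewrite eqxx.
exists e; apply/halts_withP; exists (map_config g d).
  exact: reach_simulation sim_g reach_d.
by rewrite /= halt_d.
Qed.

Lemma unary_inj : injective unary.
Proof.
move=> m n eq_mn; have := congr1 (fun t : cantor => t m) eq_mn.
have := congr1 (fun t : cantor => t n) eq_mn.
by rewrite /unary !ltnn; lia.
Qed.

(** [epsilon] yields the value of each [t] that has one and a harmless number otherwise; the bound
    is the maximum over [T]. *)
Lemma functional_relation_bounded (T : finType) (R : T -> nat -> Prop) :
  (forall t k l, R t k -> R t l -> k = l) -> exists b, forall t k, R t k -> k <= b.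
Proof.
move=> R_fun; exists (\max_t epsilon (inhabits 0) (R t)) => t k Rtk.
have -> : k = epsilon (inhabits 0) (R t).
  exact (R_fun t _ _ Rtk (epsilon_spec _ (R t) (ex_intro _ k Rtk))).
exact: leq_bigmax.
Qed.

Lemma bounded_has_max (A : nat -> Prop) b m :
  A m -> (forall k, A k -> k <= b) -> exists k, is_max A k.
Proof.
elim: b m => [|b IHb] m Am leA.
  by exists m; split=> // k /leA; lia.
have [Ab | notAb] := excluded_middle_informative (A b.+1); first by exists b.+1.
apply: IHb Am _ => k Ak; move: (leA k Ak); rewrite leq_eqVlt => /orP[/eqP ek | //].
by case: notAb; rewrite -ek.
Qed.

Lemma leq_Sigma (M : ittm) n k :
  #|work M| <= n -> halts_with M (unary 0) (unary k) -> k <= Sigma n.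
Proof.
move=> le_n halt_k; pose A k := exists2 f, BB n f & star f 0 k.
have Ak : A k.
  have [f comp_f] := computable_function_of M; have fk : star f 0 k by apply/comp_f.
  by exists f => //; split; [exists k | exists M].
(* Each value in [A] is also the output of some [code n], and there are finitely many of these. *)
have [b leb] : exists b, forall l, A l -> l <= b.
  have [b leb] := @functional_relation_bounded (code n)
    (fun e l => halts_with (decode e) (unary 0) (unary l))
    (fun e l l' hl hl' => unary_inj (halts_with_inj hl hl')).
  exists b => l [f [_ [N [leN /(_ (unary 0) (unary l)) compN]]] /compN halt_l].
  by have [e /leb] := halts_with_code leN halt_l.
by have [_ /(_ k Ak)] := epsilon_spec (inhabits 0) _ (bounded_has_max Ak leb).
Qed.

(** * The machine *)

Section Machine.

Variables (M : ittm) (r k : nat).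

(** In order: plain writers, gadgets with two states each, the rewinding state, the states of [M],
    and the two final states. *)
Definition machine_state : finType :=
  ('I_r + 'I_k * bool + unit + work M + bool)%type.

Definition plain_state (l : 'I_r) : machine_state := inl (inl (inl (inl l))).
Definition gadget_state (l : 'I_k) (b : bool) : machine_state :=
  inl (inl (inl (inr (l, b)))).
Definition rewind_state : machine_state := inl (inl (inr tt)).
Definition sim_state (q : work M) : machine_state := inl (inr q).
Definition append_state (b : bool) : machine_state := inr b.

(** An index out of range leads to the next phase, so the last writer needs no separate
    instruction. *)
Definition enter_gadget (l : nat) : machine_state :=
  if insub l is Some o then gadget_state o false else rewind_state.

Definition enter_plain (l : nat) : machine_state :=
  if insub l is Some o then plain_state o else enter_gadget 0.

Definition sim_live (q : live (work M)) : live machine_state :=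
  if q is Work q then Work (sim_state q) else Limit.

(** Where [M] halts, the lengthening phase begins. *)
Definition lift_state (q : state (work M)) : state machine_state :=
  if q is Some q then Some (sim_live q) else Some (Work (append_state false)).

Definition lift_delta (q : live (work M)) (x : symbol) :
    state machine_state * symbol * move :=
  let: (p, y, d) := delta q x in (lift_state p, y, d).

(* Writers leave the scratch bit set in the cells of the input code; the
   rewinding state clears it from right to left, so that a cell read with the
   bit already cleared is the leftmost one, on which the head is stuck.
   On cells [i], [i+1], [i+2], the states [A], [B] of a gadget act as follows
   ([F] is a finished cell, [X = (true, true, false)] and
   [G = (true, true, true)] are temporary):
     [A] writes [F] at [i]; [B] writes [X] at [i+1] and steps left; finding [F]
     it goes back and turns [X] into [G]; it writes [X] at [i+2] and steps left;
     finding [G] it turns it into [F] and leaves the gadget.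
   The next state turns the remaining [X] into [F] before meeting a blank cell.
   The final states never look for the left end of the tape: moving right to
   the first [0] of the output or, if the head is beyond it, moving left while
   filling the gap, always ends on a [1]. *)
Definition machine_delta (q : live machine_state) (x : symbol) :
    state machine_state * symbol * move :=
  let goto p := Some (Work p) in
  match q with
  | Limit => lift_delta Limit x
  | Work (inl (inr q)) => lift_delta (Work q) x
  | Work (inl (inl (inl (inl l)))) =>
      (goto (enter_plain l.+1), (true, false, true), MoveRight)
  | Work (inl (inl (inl (inr (l, false))))) =>
      match x with
      | (true, true, false) => (goto (gadget_state l false), (true, false, true), MoveRight)
      | _ => (goto (gadget_state l true), (true, false, true), MoveRight)
      end
  | Work (inl (inl (inl (inr (l, true))))) =>
      match x with
      | (false, _, _) => (goto (gadget_state l true), (true, true, false), MoveLeft)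
      | (true, true, true) => (goto (enter_gadget l.+1), (true, false, true), MoveRight)
      | (true, true, false) => (goto (gadget_state l true), (true, true, true), MoveRight)
      | (true, false, _) => (goto (gadget_state l true), x, MoveRight)
      end
  | Work (inl (inl (inr _))) =>
      match x with
      | (true, true, false) => (goto rewind_state, (true, false, true), MoveRight)
      | (false, _, _) => (goto rewind_state, x, MoveLeft)
      | (true, _, true) => (goto rewind_state, (true, false, false), MoveLeft)
      | _ => (lift_state (start M), x, MoveLeft)
      end
  | Work (inr false) =>
      let: (a, b, s) := x in
      if b then (goto (append_state false), x, MoveRight)
      else (goto (append_state true), (a, true, s), MoveLeft)
  | Work (inr true) =>
      let: (a, b, s) := x in
      if b then (None, x, MoveLeft)
      else (goto (append_state true), (a, true, s), MoveLeft)
  end.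

Definition machine : ittm :=
  @Ittm machine_state (Some (Work (enter_plain 0))) machine_delta.

Lemma card_machine : #|work machine| = r + 2 * k + 1 + #|work M| + 2.
Proof. by rewrite !card_sum card_prod !card_ord card_unit card_bool; lia. Qed.

Lemma simulation_lift : @simulation M machine lift_state.
Proof. by split=> // -[q|]; [exists (Work (sim_state q)) | exists Limit]. Qed.

Lemma enter_plain_lt l (lt_l : l < r) : enter_plain l = plain_state (Ordinal lt_l).
Proof. by rewrite /enter_plain insubT. Qed.

Lemma enter_plain_end : enter_plain r = enter_gadget 0.
Proof. by rewrite /enter_plain insubN // ltnn. Qed.

Lemma enter_gadget_lt l (lt_l : l < k) :
  enter_gadget l = gadget_state (Ordinal lt_l) false.
Proof. by rewrite /enter_gadget insubT. Qed.

Lemma enter_gadget_end : enter_gadget k = rewind_state.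
Proof. by rewrite /enter_gadget insubN // ltnn. Qed.

Lemma steps_delta (c d : config machine_state) q x q' a b s m :
  st c = Some q -> (inp c (head c), outp c (head c), scr c (head c)) = x ->
  machine_delta q x = (q', (a, b, s), m) ->
  @steps machine (Config q' (move_head m (head c)) (write (inp c) (head c) a)
    (write (outp c) (head c) b) (write (scr c) (head c) s)) d ->
  @steps machine c d.
Proof.
move=> st_c ex eq_delta steps_d; apply: (@StepsCons machine c q) => //.
by rewrite /step ex /= eq_delta.
Qed.

Lemma steps_eq (c d : config machine_state) :
  st c = st d -> head c = head d -> inp c =1 inp d -> outp c =1 outp d ->
  scr c =1 scr d -> @steps machine c d.
Proof.
case: c d => [q i t1 t2 t3] [q' i' t1' t2' t3'] /= -> -> e1 e2 e3.
rewrite (functional_extensionality _ _ e1) (functional_extensionality _ _ e2).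
rewrite (functional_extensionality _ _ e3); exact: StepsRefl.
Qed.

(** * Writing the input *)

Definition written (q : machine_state) (i : nat) : config machine_state :=
  Config (Some (Work q)) i (unary i) (fun=> false) (unary i).

Ltac tape := rewrite /= /write /unary /=; repeat (case: ifP => ?);
  repeat congr (_, _); lia.

Lemma steps_plain l : l <= r ->
  @steps machine (init machine (unary 0)) (written (enter_plain l) l).
Proof.
elim: l => [_|l IHl lt_l]; first by apply: steps_eq.
apply: steps_trans (IHl (ltnW lt_l)) _; rewrite (enter_plain_lt lt_l).
by apply: steps_delta => //=; apply: steps_eq => //= j; tape.
Qed.

(** A gadget ends in front of a leftover [X]; whichever state follows, a further gadget or the
    rewinding state, finishes that cell and stays in place as a state. *)
Lemma enter_gadget_skip l :
  machine_delta (Work (enter_gadget l)) (true, true, false) =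
    (Some (Work (enter_gadget l)), (true, false, true), MoveRight).
Proof. by rewrite /enter_gadget; case: insub. Qed.

Lemma steps_gadget l i : l < k ->
  @steps machine (written (enter_gadget l) i) (written (enter_gadget l.+1) (i + 3)).
Proof.
move=> lt_l; rewrite (enter_gadget_lt lt_l).
(* The head visits [i], [i+1], [i], [i+1], [i+2], [i+1], [i+2]; the last of these steps is made by
   the state following the gadget. *)
apply: (steps_delta (x := (false, false, false))) => //=; first by tape.
apply: (steps_delta (x := (false, false, false))) => //=; first by tape.
apply: (steps_delta (x := (true, false, true))) => //=; first by tape.
apply: (steps_delta (x := (true, true, false))) => //=; first by tape.
apply: (steps_delta (x := (false, false, false))) => //=; first by tape.
apply: (steps_delta (x := (true, true, true))) => //=; first by tape.
apply: steps_delta (enter_gadget_skip l.+1) _ => //=; first by tape.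
by apply: steps_eq => //= [|j|j|j]; tape.
Qed.

Lemma steps_gadgets l i : l <= k ->
  @steps machine (written (enter_gadget 0) i) (written (enter_gadget l) (i + 3 * l)).
Proof.
elim: l => [_|l IHl lt_l]; first by rewrite muln0 addn0; apply: StepsRefl.
apply: steps_trans (IHl (ltnW lt_l)) _.
by rewrite mulnSr addnA; apply: steps_gadget.
Qed.

Lemma steps_rewind n i : i < n ->
  @steps machine
    (Config (Some (Work rewind_state)) i (unary n) (fun=> false) (unary i.+1))
    (map_config lift_state (init M (unary n))).
Proof.
elim: i => [|i IHi] lt_i.
  (* On cell 0 the left move is stuck, so the second visit sees the cleared bit and starts [M] with
     the head at 0. *)
  apply: (steps_delta (x := (true, false, true))) => //; first by tape.
  apply: (steps_delta (x := (true, false, false))) => //.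
  by apply: steps_eq => //= j; tape.
apply: (steps_delta (x := (true, false, true))) => //; first by tape.
apply: steps_trans (IHi (ltnW lt_i)).
by apply: steps_eq => //= j; tape.
Qed.

Lemma steps_write_input n : n = r + 3 * k -> 0 < n ->
  @steps machine (init machine (unary 0)) (map_config lift_state (init M (unary n))).
Proof.
move=> en n_gt0; apply: steps_trans (steps_plain (leqnn r)) _.
rewrite enter_plain_end; apply: steps_trans (steps_gadgets _ (leqnn k)) _.
rewrite enter_gadget_end -en; case: n n_gt0 {en} => // n _.
(* The head stands on the blank cell after the code; as the code is nonempty, a left move reaches
   its last cell. *)
apply: (steps_delta (x := (false, false, false))) => //; first by tape.
apply: steps_trans (steps_rewind (ltnSn n)).
by apply: steps_eq => //= j; tape.
Qed.

(** * Lengthening the output *)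

Lemma steps_fill (c : config machine_state) m p :
  st c = Some (Work (append_state true)) -> m <= p -> head c < p ->
  (forall j, outp c j = (j < m) || (head c < j < p)) ->
  exists2 d, @steps machine c d & st d = None /\ outp d = unary p.
Proof.
have done_fill (e : config machine_state) : st e = Some (Work (append_state true)) ->
    outp e =1 unary p -> head e < p ->
    exists2 d, @steps machine e d & st d = None /\ outp d = unary p.
  move=> st_e out_e lt_p; eexists.
    apply: steps_delta st_e erefl _ _; first by rewrite /= out_e /unary lt_p.
    exact: StepsRefl.
  split=> //; apply: functional_extensionality => j /=; rewrite /write out_e.
  by case: eqP => // ->.
have fill_step (e : config machine_state) : st e = Some (Work (append_state true)) ->
    outp e (head e) = false -> exists e', [/\ forall d, @steps machine e' d -> @steps machine e d,
    st e' = Some (Work (append_state true)), head e' = (head e).-1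
     & outp e' =1 write (outp e) (head e) true].
  move=> st_e out_e; eexists; split.
  - move=> d; apply: steps_delta st_e erefl _; by rewrite /= out_e.
  - by [].
  - by [].
  - by [].
(* Induction on the head position: each left move fills one cell of the gap, until the head is below
   [m] and the output is already [unary p]. *)
move ei: (head c) => i; elim: i c m ei => [|i IHi] c m ei st_c le_m lt_p out_c.
  case: (posnP m) => [m0 | m_gt0]; last first.
    by apply: done_fill => [//|j|]; [rewrite out_c /unary; lia | rewrite ei].
  have [|e [steps_e st_e hd_e out_e]] := fill_step c st_c; first by rewrite out_c ei m0.
  (* With [m = 0] cell 0 has just been filled; the head is stuck there and next reads the new
     one. *)
  have [||d steps_d dP] := done_fill e st_e; last by exists d => //; apply: steps_e.
    by move=> j; rewrite out_e /write out_c ei m0 /unary; case: eqP; lia.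
  by rewrite hd_e ei.
have [lt_m | le_mi] := ltnP i.+1 m.
  by apply: done_fill => [//|j|]; [rewrite out_c /unary; lia | rewrite ei].
have [|e [steps_e st_e hd_e out_e]] := fill_step c st_c; first by rewrite out_c ei; lia.
have [|||d steps_d dP] := IHi e m _ st_e le_m; last by exists d => //; apply: steps_e.
- by rewrite hd_e ei.
- by lia.
- by move=> j; rewrite out_e /write out_c ei; case: eqP; lia.
Qed.

Lemma steps_append_here (c : config machine_state) m :
  st c = Some (Work (append_state false)) -> outp c =1 unary m -> m <= head c ->
  exists2 d, @steps machine c d & st d = None /\ outp d = unary (head c).+1.
Proof.
move=> st_c out_c le_m.
have steps_c d := steps_delta (d := d) st_c erefl.
have out_hd : outp c (head c) = false by rewrite out_c /unary; lia.
rewrite /= out_hd in steps_c.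
set c' : config machine_state := Config (Some (Work (append_state true))) (head c).-1
  (write (inp c) (head c) (inp c (head c))) (write (outp c) (head c) true)
  (write (scr c) (head c) (scr c (head c))).
(* If the head is on cell 0, it stays on the one just written, so the initial block of ones has
   length 1; otherwise it is still [m]. *)
have [||||d steps_d dP] := @steps_fill c' (if head c is 0 then 1 else m) (head c).+1.
- by [].
- by case: (head c) le_m => //; lia.
- by rewrite /=; lia.
- move=> j; rewrite /= /write out_c /unary.
  by case: (head c) le_m => [|i] le_m; case: eqP; lia.
by exists d => //; apply: steps_c erefl steps_d.
Qed.

(** [M] may halt with its head anywhere; the induction is on the distance to the first zero of the
    output. *)
Lemma steps_append (c : config machine_state) m :
  st c = Some (Work (append_state false)) -> outp c =1 unary m ->
  exists d p, [/\ @steps machine c d, st d = None, outp d = unary p & m < p].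
Proof.
move eh: (m - head c) => h; elim: h c eh => [|h IHh] c eh st_c out_c.
  have [|d steps_d [st_d out_d]] := steps_append_here st_c out_c; first by lia.
  by exists d, (head c).+1; split=> //; lia.
have out_hd : outp c (head c) by rewrite out_c /unary; lia.
have steps_c d := steps_delta (d := d) st_c erefl.
rewrite /= out_hd in steps_c.
set c' : config machine_state := Config (Some (Work (append_state false))) (head c).+1
  (write (inp c) (head c) (inp c (head c))) (write (outp c) (head c) true)
  (write (scr c) (head c) (scr c (head c))).
have [|//||d [p [steps_d st_d out_d lt_p]]] := IHh c'.
- by rewrite subnS eh.
- by move=> j; rewrite /= /write -out_c; case: eqP => // ->.
by exists d, p; split=> //; apply: steps_c erefl steps_d.
Qed.

Lemma halts_with_machine n m : n = r + 3 * k -> 0 < n ->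
  halts_with M (unary n) (unary m) ->
  exists2 p, halts_with machine (unary 0) (unary p) & m < p.
Proof.
move=> en n_gt0 /halts_withP[d reach_d [st_d out_d]].
have reach_sim := reach_steps_left (steps_write_input en n_gt0)
  (reach_simulation simulation_lift reach_d).
have [||e [p [steps_e st_e out_e lt_p]]] := @steps_append (map_config lift_state d) m.
- by rewrite /= st_d.
- by rewrite /= out_d.
exists p => //; apply/halts_withP; exists e => //.
exact: reach_steps_right reach_sim steps_e.
Qed.

End Machine.

(* fstar is f^*, total by Hstar. *)
Theorem theorem1 (f : cantor -> option cantor) (Hf : IT_C f)
    (fstar : nat -> nat) (Hstar : forall n : nat, star f n (fstar n)) :
  eventually_gt Sigma fstar.
Proof.
(* Each gadget saves one state; [k] of them pay exactly for the states of [M], the rewinding state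
   and the two final states, so the machine has [n] working states. *)
have [M comp_M] := Hf; pose k := #|work M| + 3.
exists (3 * k) => n le_n; pose r := n - 3 * k.
have [||| p halt_p lt_p] := @halts_with_machine M r k n (fstar n).
- by rewrite /r; lia.
- by rewrite /k in le_n *; lia.
- exact/comp_M/Hstar.
apply: leq_trans lt_p (leq_Sigma _ halt_p).
by rewrite card_machine /r; rewrite /k in le_n *; lia.
Qed.
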